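(* Let $H$ be a separable Hilbert space, let $(X_t)_{t\geq 1}$ be an $H$-valued process and $(\epsilon_t)_{t\geq1}$ a real-valued process, and let $(\mathcal{F}_t)_{t\geq 0}$ be a filtration such that for all $t\geq 1$: $X_t$ is $\mathcal{F}_{t-1}$-measurable, $\epsilon_t$ is $\mathcal{F}_t$-measurable, and $\mathbb{E}[\epsilon_t\mid\mathcal{F}_{t-1}]=0$. Fix $\rho>0$ and set $V_t=\sum_{i\leq t}X_iX_i^T$, $M_t=\sum_{i\le t}X_i\epsilon_i$, and $G_t=(\rho I+V_t)^{-1/2}X_t$. For $\lambda>0$ let $$e_t(\lambda)=\|G_t\|^2\,\mathbb{E}\big[\exp(\lambda|\epsilon_t|)-\lambda|\epsilon_t|-1\,\big|\,\mathcal{F}_{t-1}\big].$$ Then the process $$S_t=\cosh\Big(\lambda\big\|(\rho I+V_t)^{-1/2}M_t\big\|\Big)\exp\Big(-\sum_{i\leq t}e_i(\lambda)\Big)$$ is a nonnegative supermartingale with respect to $(\mathcal{F}_t)$.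
   Context: For $f,g\in H$, $fg^T$ denotes the operator $f\langle g,\cdot\rangle$ on $H$, and $I$ is the identity operator on $H$. *)

(* Defs.v *)
From HB Require Import structures.
From mathcomp Require Import all_boot all_order all_algebra.
From mathcomp Require Import all_classical all_reals all_analysis.
From Stdlib Require Import ClassicalEpsilon.
Set Implicit Arguments. Unset Strict Implicit. Unset Printing Implicit Defensive.
Import Order.TTheory GRing.Theory Num.Theory.
Import numFieldNormedType.Exports.
Local Open Scope classical_set_scope.
Local Open Scope ring_scope.

Section Hilbert.
Variables (R : realType) (H : completeNormedModType R).

Definition is_separable_hilbert (inner : H -> H -> R) : Prop :=
  [/\ (forall x y, inner x y = inner y x),
      (forall a x y z, inner (a *: x + y) z = a * inner x z + inner y z),
      (forall x, inner x x = `|x| ^+ 2) &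
      exists D : set H, countable D /\ closure D = setT].

Variable inner : H -> H -> R.

Definition rank1 (f g : H) : H -> H := fun x => inner g x *: f.

Definition is_inv_sqrt (A B : H -> H) : Prop :=
  [/\ (forall (a : R) x y, B (a *: x + y) = a *: B x + B y), continuous B,
      (forall x y, inner (B x) y = inner x (B y)),
      (forall x, 0 <= inner x (B x)) &
      (forall x, B (B (A x)) = x /\ A (B (B x)) = x)].

(** A^{-1/2} (chosen by description; it is unique when it exists) *)
Definition op_inv_sqrt (A : H -> H) : H -> H :=
  epsilon (inhabits (@id H)) (is_inv_sqrt A).

End Hilbert.

Definition cosh {R : realType} (x : R) : R := (expR x + expR (- x)) / 2.

Section Prob.
Context {d : measure_display} {Omega : measurableType d} {R : realType}.
Variable P : probability Omega R.

(** f is G-measurable (Borel sigma-algebra on the topological codomain) *)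
Definition meas_wrt {T : topologicalType} (G : set (set Omega))
  (f : Omega -> T) : Prop :=
  forall U : set T, open U -> G (f @^-1` U).

Definition is_filtration (F : nat -> set (set Omega)) : Prop :=
  [/\ (forall t, sigma_algebra setT (F t)),
      (forall t, F t `<=` measurable) &
      (forall s t, (s <= t)%N -> F s `<=` F t)].

Definition is_cond_exp (G : set (set Omega)) (Y Z : Omega -> R) : Prop :=
  [/\ P.-integrable setT (EFin \o Y), meas_wrt G Z,
      P.-integrable setT (EFin \o Z) &
      forall A, G A -> (\int[P]_(w in A) (Z w)%:E = \int[P]_(w in A) (Y w)%:E)%E].

Definition is_cond_exp_nneg (G : set (set Omega)) (Y : Omega -> R)
  (Z : Omega -> \bar R) : Prop :=
  [/\ meas_wrt G Z, (forall w, (0 <= Z w)%E) &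
      forall A, G A -> (\int[P]_(w in A) Z w = \int[P]_(w in A) (Y w)%:E)%E].

Definition nonneg_supermartingale (F : nat -> set (set Omega))
  (S : nat -> Omega -> R) : Prop :=
  [/\ (forall t w, 0 <= S t w),
      (forall t, meas_wrt (F t) (S t)),
      (forall t, P.-integrable setT (EFin \o S t)) &
      (forall t Z, is_cond_exp (F t) (S t.+1) Z ->
         {ae P, forall w, Z w <= S t w})].

End Prob.

(* Main.v *)
Require Import Defs.
From HB Require Import structures.
From mathcomp Require Import all_boot all_order all_algebra.
From mathcomp Require Import all_classical all_reals all_analysis.
From mathcomp Require Import measurable_realfun ring lra.
From Stdlib Require Import ClassicalEpsilon.
Import Order.TTheory GRing.Theory Num.Theory.
Import numFieldNormedType.Exports.
Local Open Scope classical_set_scope.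
Local Open Scope ring_scope.
Set Implicit Arguments.
Unset Strict Implicit.
Unset Printing Implicit Defensive.

(** With [C_t = (rho I + V_t)^-1], only [|K_t x|^2 = <x, C_t x>] matters.  The
    function [z |-> cosh (sqrt z)] is convex, being a power series with
    nonnegative coefficients; hence [cosh |u + s v|] is convex in [<u, v>] and it
    suffices to bound it at the collinear cases [<u, v> = +- |u| |v|].  This gives
    [cosh |u + s v| <= cosh |u| (e^(|s||v|) - |s||v|) + s L] with [L] free of [s].
    Taking [u = lambda K_t M_(t-1)], [v = lambda G_t], [s = eps_t], the last term is
    centred, [|G_t| <= 1] turns the exponential remainder into
    [|G_t|^2 (e^(lambda |s|) - lambda |s| - 1)], and [|K_t x| <= |K_(t-1) x|]
    together with [1 + y <= e^y] closes the one-step inequality.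

    The square root of [rho C_t] is the limit of the iteration
    [Y |-> (T + Y^2) / 2] with [T = 1 - rho C_t] a contraction, and [C_t] is given
    by the Sherman-Morrison recursion, which also yields its measurability. *)

(** * Exponential inequalities *)

Section ExpInequalities.
Variable R : realType.
Implicit Types (x y a b r s c : R) (n k : nat).

(** Expanding every exponential, the term of order [n] of the conclusion is the quantity of the
    hypothesis over [n!]; [c0] and [c1] correct orders 0 and 1. Inequalities between exponentials
    thus reduce to termwise checks. *)
Lemma expR_series_ge0 (l : seq (R * R)) (c0 c1 : R) :
  (forall n, 0 <= \sum_(p <- l) p.1 * p.2 ^+ n
                  + c0 * (n == 0)%:R + c1 * (n == 1)%:R) ->
  0 <= \sum_(p <- l) p.1 * expR p.2 + c0 + c1.
Proof.
move=> coef_ge0.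
pose u N := \sum_(p <- l) p.1 * series (exp_coeff p.2) N + c0 + c1.
have u_cvg : u n @[n --> \oo] --> \sum_(p <- l) p.1 * expR p.2 + c0 + c1.
  apply: cvgD; last exact: cvg_cst.
  apply: cvgD; last exact: cvg_cst.
  elim: l {coef_ge0 u} => [|p l IH].
    by under eq_fun do rewrite big_nil; rewrite big_nil; exact: cvg_cst.
  under eq_fun do rewrite big_cons; rewrite big_cons.
  apply: cvgD IH; apply: cvgMr; exact: is_cvg_series_exp_coeff.
rewrite -(cvg_lim _ u_cvg)//; apply: limr_ge; first by apply/cvg_ex; eexists; exact: u_cvg.
(* A partial sum needs two terms to contain both orders that absorb [c0] and [c1]. *)
exists 2%N => // N /= N2.
have -> : u N = \sum_(0 <= n < N) (\sum_(p <- l) p.1 * p.2 ^+ n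
            + c0 * (n == 0)%:R + c1 * (n == 1)%:R) / n`!%:R.
  rewrite /u -{1}[c0 in LHS]mulr1 -{1}[c1 in LHS]mulr1.
  under [RHS]eq_bigr do rewrite !mulrDl mulr_suml -!mulrA.
  rewrite !big_split/= exchange_big/=; congr (_ + _ + _).
  - apply: eq_bigr => p _; rewrite /series/= mulr_sumr; apply: eq_bigr => n _.
    by rewrite /exp_coeff/= -mulrA.
  - rewrite -(subnKC N2) add2n big_nat_recl// big1 ?addr0; last first.
      by move=> i _; rewrite mul0r mulr0.
    by rewrite eqxx fact0 mul1r invr1.
  - rewrite -(subnKC N2) add2n big_nat_recl// big_nat_recl// big1 ?addr0; last first.
      by move=> i _; rewrite mul0r mulr0.
    by rewrite /= mul0r mulr0 add0r mul1r invr1.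
by apply: sumr_ge0 => n _; rewrite divr_ge0.
Qed.

(** Even orders of [sinh] cancel, odd ones are nonnegative, and order 1 is exactly [r]. *)
Lemma sinh_ge_id r : 0 <= r -> r <= (expR r - expR (- r)) / 2.
Proof.
move=> r0.
have : 0 <= \sum_(t <- [:: (2^-1, r); (- 2^-1, - r)]) t.1 * expR t.2 + 0 - r.
  apply: expR_series_ge0 => n; rewrite !big_cons !big_nil/=.
  case: n => [|[|n]]; rewrite /= ?expr0 ?expr1; try lra.
  rewrite exprNn -signr_odd.
  have := exprn_ge0 n.+2 r0; case: (odd _); rewrite ?expr0 ?expr1; lra.
rewrite !big_cons !big_nil/=; lra.
Qed.

(** Orders 0 and 1 cancel; from order 2 on, [b ^+ n <= b ^+ 2]. *)
Lemma expR_sub_affine_scale b x : 0 <= b <= 1 -> 0 <= x ->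
  expR (b * x) - b * x - 1 <= b ^+ 2 * (expR x - x - 1).
Proof.
move=> /andP[b0 b1] x0.
have : 0 <= \sum_(t <- [:: (b ^+ 2, x); (- 1, b * x)]) t.1 * expR t.2
    + (1 - b ^+ 2) + (b * x - b ^+ 2 * x).
  apply: expR_series_ge0 => n; rewrite !big_cons !big_nil/=.
  case: n => [|[|n]]; rewrite /= ?expr0 ?expr1; try lra.
  have : b ^+ n.+2 <= b ^+ 2 by rewrite -addn2 exprD ler_piMl ?exprn_ile1 ?exprn_ge0.
  have := exprn_ge0 n.+2 x0; rewrite exprMn; nra.
rewrite !big_cons !big_nil/=; lra.
Qed.

Lemma exprn_convex k a b s : 0 <= a -> 0 <= b -> 0 <= s <= 1 ->
  (s * a + (1 - s) * b) ^+ k <= s * a ^+ k + (1 - s) * b ^+ k.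
Proof.
move=> a0 b0 /andP[s0 s1]; elim: k => [|k IH]; first by rewrite !expr0; lra.
have m0 : 0 <= s * a + (1 - s) * b by rewrite addr_ge0// mulr_ge0// subr_ge0.
rewrite exprS (le_trans (ler_wpM2l m0 IH))// !exprS -subr_ge0.
(* Both differences in this product have the same sign, powers being monotone on nonnegative
   reals. *)
have -> : s * (a * a ^+ k) + (1 - s) * (b * b ^+ k) -
  (s * a + (1 - s) * b) * (s * a ^+ k + (1 - s) * b ^+ k) =
  s * (1 - s) * ((a - b) * (a ^+ k - b ^+ k)) by ring.
apply: mulr_ge0; first by rewrite mulr_ge0// subr_ge0.
have [ab|/ltW ba] := leP a b.
  by rewrite mulr_le0// subr_le0// lerXn2r.
by rewrite mulr_ge0// subr_ge0// lerXn2r.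
Qed.

(** Convexity of [cosh (sqrt z)], phrased through squares so that the signs of [p], [q], [z] are
    free. Odd orders cancel between each point and its opposite; order [2m] is convexity of the
    [m]-th power at [p ^+ 2] and [q ^+ 2]. *)
Lemma cosh_sqr_convex p q z s : 0 <= s <= 1 ->
  z ^+ 2 = s * p ^+ 2 + (1 - s) * q ^+ 2 ->
  cosh z <= s * cosh p + (1 - s) * cosh q.
Proof.
move=> s01 zE; have /andP[s0 s1] := s01.
have : 0 <= \sum_(t <- [:: (s / 2, p); (s / 2, - p); ((1 - s) / 2, q);
    ((1 - s) / 2, - q); (- 2^-1, z); (- 2^-1, - z)]) t.1 * expR t.2 + 0 + 0.
  apply: expR_series_ge0 => n; rewrite !big_cons !big_nil/= !mul0r !addr0.
  rewrite (exprNn p) (exprNn q) (exprNn z) -(signr_odd _ n).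
  have [_|ev] := boolP (odd n); first by rewrite expr1; lra.
  rewrite expr0 !mul1r -(even_halfK ev) -mul2n !exprM zE.
  have := @exprn_convex n./2 (p ^+ 2) (q ^+ 2) s (sqr_ge0 _) (sqr_ge0 _) s01; lra.
rewrite !big_cons !big_nil/= /cosh; lra.
Qed.

(** The gap between the sides equals [e^(-a) (sinh y - y)] for [y >= 0] and [e^a (sinh |y| - |y|)]
    for [y <= 0]. The term linear in [y] is kept apart because it will be centred. *)
Lemma cosh_shift_le a y : 0 <= a ->
  cosh (a + y) <= cosh a * (expR `|y| - `|y|) + y * ((expR a - expR (- a)) / 2).
Proof.
move=> a0; rewrite /cosh opprD !expRD.
have [y0|/ltW y0] := leP 0 y.
  rewrite ger0_norm// -subr_ge0.
  have : 0 <= expR (- a) * ((expR y - expR (- y)) / 2 - y).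
    by rewrite mulr_ge0 ?expR_ge0// subr_ge0 sinh_ge_id.
  lra.
rewrite ler0_norm// -subr_ge0.
have : 0 <= expR a * ((expR (- y) - expR (- - y)) / 2 - (- y)).
  by rewrite mulr_ge0 ?expR_ge0// subr_ge0 sinh_ge_id// oppr_ge0.
rewrite opprK; lra.
Qed.

Lemma ler_cosh a b : 0 <= a -> a <= b -> cosh a <= cosh b.
Proof.
move=> a0 ab.
(* This product is [2 (cosh b - cosh a)]. *)
have : 0 <= (expR b - expR a) * (1 - expR (- a) * expR (- b)).
  by rewrite mulr_ge0 ?subr_ge0 ?ler_expR// -expRD -expR0 ler_expR; lra.
have -> : (expR b - expR a) * (1 - expR (- a) * expR (- b)) = expR b - expR a
    - expR (- a) * (expR b * expR (- b)) + expR a * expR (- a) * expR (- b) by ring.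
by rewrite !expRxMexpNx_1 /cosh; lra.
Qed.

Lemma cosh_ge0 a : 0 <= cosh a.
Proof. by rewrite divr_ge0// addr_ge0// expR_ge0. Qed.

End ExpInequalities.

(** * Regularized Gram operators *)

Section HilbertOperators.
Variables (R : realType) (H : completeNormedModType R) (inner : H -> H -> R).
Hypothesis innerC : forall x y, inner x y = inner y x.
Hypothesis inner_linear : forall a x y z,
  inner (a *: x + y) z = a * inner x z + inner y z.
Hypothesis inner_norm : forall x, inner x x = `|x| ^+ 2.

Lemma innerDl x y z : inner (x + y) z = inner x z + inner y z.
Proof. by rewrite -{1}[x]scale1r inner_linear mul1r. Qed.

Lemma inner0l z : inner 0 z = 0.
Proof. by apply: (@addrI _ (inner 0 z)); rewrite -innerDl !addr0. Qed.

Lemma innerZl a x z : inner (a *: x) z = a * inner x z.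
Proof. by rewrite -[a *: x]addr0 inner_linear inner0l addr0. Qed.

Lemma innerNl x z : inner (- x) z = - inner x z.
Proof. by rewrite -scaleN1r innerZl mulN1r. Qed.

Lemma innerDr x y z : inner z (x + y) = inner z x + inner z y.
Proof. by rewrite innerC innerDl !(innerC z). Qed.

Lemma innerZr a x z : inner z (a *: x) = a * inner z x.
Proof. by rewrite innerC innerZl (innerC z). Qed.

Lemma innerNr x z : inner z (- x) = - inner z x.
Proof. by rewrite innerC innerNl (innerC z). Qed.

Lemma inner_suml (I : Type) (l : seq I) (Q : pred I) (f : I -> H) z :
  inner (\sum_(i <- l | Q i) f i) z = \sum_(i <- l | Q i) inner (f i) z.
Proof.
apply: (big_morph (fun x => inner x z)); last exact: inner0l.
by move=> x y; exact: innerDl.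
Qed.

Lemma inner_sumr (I : Type) (l : seq I) (Q : pred I) (f : I -> H) z :
  inner z (\sum_(i <- l | Q i) f i) = \sum_(i <- l | Q i) inner z (f i).
Proof. by rewrite innerC inner_suml; apply: eq_bigr => i _; rewrite innerC. Qed.

Lemma sqr_normD x y : `|x + y| ^+ 2 = `|x| ^+ 2 + 2 * inner x y + `|y| ^+ 2.
Proof.
by rewrite -!inner_norm !innerDl !innerDr (innerC y x); ring.
Qed.

Lemma innerE_norm x y : inner x y = (`|x + y| ^+ 2 - `|x| ^+ 2 - `|y| ^+ 2) / 2.
Proof. by rewrite sqr_normD; field. Qed.

Lemma innerE_dist x y : inner x y = (`|x| ^+ 2 + `|y| ^+ 2 - `|x - y| ^+ 2) / 2.
Proof. by rewrite sqr_normD innerNr normrN; field. Qed.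

(** The triangle inequality is already available for the norm, and squaring it gives
    Cauchy-Schwarz. *)
Lemma inner_le_norm x y : inner x y <= `|x| * `|y|.
Proof.
have : `|x + y| ^+ 2 <= (`|x| + `|y|) ^+ 2.
  by rewrite lerXn2r ?nnegrE ?addr_ge0 ?ler_normD.
rewrite sqr_normD; lra.
Qed.

Lemma norm_inner_le x y : `|inner x y| <= `|x| * `|y|.
Proof.
rewrite ler_norml inner_le_norm andbT lerNl -innerNl -(normrN x).
exact: inner_le_norm.
Qed.

Lemma cvg_innerl (u : nat -> H) (l z : H) : u n @[n --> \oo] --> l ->
  inner (u n) z @[n --> \oo] --> inner l z.
Proof.
move=> ul; under eq_fun do rewrite innerE_norm; rewrite innerE_norm.
apply: cvgMl; apply: cvgB; last exact: cvg_cst.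
by apply: cvgB; rewrite !expr2; apply: cvgM; apply: cvg_norm => //;
  apply: cvgD => //; exact: cvg_cst.
Qed.

Lemma cosh_norm_shift_le (u v : H) (s : R) :
  cosh `|u + s *: v| <= cosh `|u| * (expR (`|s| * `|v|) - `|s| * `|v|)
    + s * (inner u v / `|u| * ((expR `|u| - expR (- `|u|)) / 2)).
Proof.
set a := `|u|; set b := `|v|; set c := inner u v.
(* The cosine of the angle between [u] and [v]. If [a * b = 0], then [k = 0] by the division
   convention and [c = 0] by Cauchy-Schwarz, so [c = k * (a * b)] survives. *)
pose k := c / (a * b).
have a0 : 0 <= a by exact: normr_ge0.
have b0 : 0 <= b by exact: normr_ge0.
have cab : `|c| <= a * b by exact: norm_inner_le.
have cE : c = k * (a * b).
  have [ab0|ab0] := eqVneq (a * b) 0; last by rewrite /k divfK.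
  by apply/eqP; rewrite ab0 mulr0 -normr_le0 -ab0.
have k1 : `|k| <= 1.
  rewrite /k normrM normfV (ger0_norm (mulr_ge0 a0 b0)).
  have [->|ab0] := eqVneq (a * b) 0; first by rewrite invr0 mulr0 ler01.
  by rewrite ler_pdivrMr ?mul1r// lt_neqAle eq_sym ab0 mulr_ge0.
have LE : c / a * ((expR a - expR (- a)) / 2) = k * b * ((expR a - expR (- a)) / 2).
  have [->|an0] := eqVneq a 0; first by rewrite oppr0 subrr mul0r !mulr0.
  by rewrite {1}cE; congr (_ * _); field.
rewrite LE.
(* With weights [(1 + k) / 2] and [(1 - k) / 2], the mean of [(a + s b)^2] and [(a - s b)^2] is
   [a^2 + 2 s c + s^2 b^2], the square of [|u + s v|]. The linear terms of the two shift bounds then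
   average to [k s b sinh a]. *)
have := @cosh_sqr_convex R (a + s * b) (a - s * b) `|u + s *: v| ((1 + k) / 2).
have := cosh_shift_le (s * b) a0; have := cosh_shift_le (- (s * b)) a0.
rewrite normrN normrM (ger0_norm b0).
move: k1; rewrite ler_norml => /andP[k1 k2] h1 h2 h3.
apply: le_trans (h3 _ _) _.
- by apply/andP; split; lra.
- rewrite sqr_normD innerZr -/a -/c normrZ -/b exprMn real_normK ?num_real// cE; by field.
have K1 : 0 <= (1 + k) / 2 by lra.
have K2 : 0 <= 1 - (1 + k) / 2 by lra.
apply: le_trans (lerD (ler_wpM2l K1 h2) (ler_wpM2l K2 h1)) _.
by rewrite le_eqVlt; apply/orP; left; apply/eqP; field.
Qed.

(** * Linear operators and the square root of one minus a contraction *)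

Lemma linear_op0 (B : H -> H) :
  (forall a x y, B (a *: x + y) = a *: B x + B y) -> B 0 = 0.
Proof.
by move=> BL; have := BL (- 1) 0 0; rewrite !scaleN1r oppr0 addr0 addNr.
Qed.

Lemma linear_opD (B : H -> H) :
  (forall a x y, B (a *: x + y) = a *: B x + B y) -> {morph B : x y / x + y}.
Proof. by move=> BL x y; have := BL 1 x y; rewrite !scale1r. Qed.

Lemma linear_opZ (B : H -> H) :
  (forall a x y, B (a *: x + y) = a *: B x + B y) ->
  forall a, {morph B : x / a *: x}.
Proof. by move=> BL a x; have := BL a x 0; rewrite (linear_op0 BL) !addr0. Qed.

Lemma linear_opB (B : H -> H) :
  (forall a x y, B (a *: x + y) = a *: B x + B y) -> {morph B : x y / x - y}.
Proof.
by move=> BL x y; have := BL (- 1) y x; rewrite !scaleN1r !(addrC _ x) (addrC _ (B x)).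
Qed.

(* The fixed points of [Y |-> (T + Y^2) / 2] satisfy [(1 - Y)^2 = 1 - T]. *)
Fixpoint sqrt_iter (T : H -> H) n : H -> H :=
  if n is m.+1 then
    fun x => 2^-1 *: (T x + sqrt_iter T m (sqrt_iter T m x))
  else fun=> 0.

(** The same iteration run on the scalar [T = 1]; it majorizes both the norms and the increments of
    the operator iteration. *)
Fixpoint sqrt_iter_bound n : R :=
  if n is m.+1 then (1 + sqrt_iter_bound m ^+ 2) / 2 else 0.

Lemma sqrt_iter_bound01 n : 0 <= sqrt_iter_bound n <= 1.
Proof. elim: n => [|n /= IH]; [by rewrite lexx ler01|apply/andP; split; nra]. Qed.

Section SqrtContraction.
Variable T : H -> H.
Hypothesis T_linear : forall a x y, T (a *: x + y) = a *: T x + T y.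
Hypothesis T_sym : forall x y, inner (T x) y = inner x (T y).
Hypothesis T_contr : forall x, `|T x| <= `|x|.

Let Y := sqrt_iter T.

Lemma sqrt_iter_linear n a x y : Y n (a *: x + y) = a *: Y n x + Y n y.
Proof.
elim: n a x y => [|n IH] a x y /=; first by rewrite /Y/= scaler0 addr0.
rewrite /Y/= -/Y !IH T_linear scalerA mulrC -scalerA -scalerDr; congr (_ *: _).
by rewrite scalerDr addrACA.
Qed.

Lemma sqrt_iter_sym n x y : inner (Y n x) y = inner x (Y n y).
Proof.
elim: n x y => [|n IH] x y; first by rewrite inner0l innerC inner0l.
by rewrite /Y/= -/Y innerZl innerZr innerDl innerDr T_sym !IH.
Qed.

Lemma sqrt_iter_le n x : `|Y n x| <= sqrt_iter_bound n * `|x|.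
Proof.
elim: n x => [|n IH] x; first by rewrite normr0 mul0r.
rewrite /Y/= -/Y normrZ ger0_norm; last by lra.
have /andP[b0 b1] := sqrt_iter_bound01 n.
have h1 : `|T x + Y n (Y n x)| <= `|T x| + `|Y n (Y n x)| by exact: ler_normD.
have h2 := T_contr x; have h3 := IH (Y n x).
have h4 := ler_wpM2l b0 (IH x); lra.
Qed.

Lemma sqrt_iter_step n x :
  `|Y n.+1 x - Y n x| <= (sqrt_iter_bound n.+1 - sqrt_iter_bound n) * `|x|.
Proof.
elim: n x => [|n IH] x.
  rewrite /Y/= !subr0 addr0 normrZ ger0_norm; last by lra.
  have := T_contr x; lra.
(* Half the difference of two squares, split as [Y' (Y' - Y) + (Y' - Y) Y]; each piece is bounded by
   a majorant times an increment. *)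
have -> : Y n.+2 x - Y n.+1 x =
    2^-1 *: (Y n.+1 (Y n.+1 x - Y n x) + (Y n.+1 (Y n x) - Y n (Y n x))).
  rewrite (linear_opB (@sqrt_iter_linear n.+1)) addrA subrK.
  by rewrite {1 2}/Y/= -/Y -scalerBr opprD addrACA subrr add0r.
rewrite normrZ ger0_norm; last by lra.
have /andP[b0 b1] := sqrt_iter_bound01 n.
have /andP[c0 c1] := sqrt_iter_bound01 n.+1.
have h1 := ler_normD (Y n.+1 (Y n.+1 x - Y n x)) (Y n.+1 (Y n x) - Y n (Y n x)).
have h2 := sqrt_iter_le n.+1 (Y n.+1 x - Y n x).
have h3 := ler_wpM2l c0 (IH x).
have h4 := IH (Y n x).
have d0 : 0 <= sqrt_iter_bound n.+1 - sqrt_iter_bound n by rewrite /=; nra.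
have h5 := ler_wpM2l d0 (sqrt_iter_le n x).
have -> : sqrt_iter_bound n.+2 - sqrt_iter_bound n.+1 =
    (sqrt_iter_bound n.+1 ^+ 2 - sqrt_iter_bound n ^+ 2) / 2.
  by rewrite /=; field.
lra.
Qed.

(** The increments are dominated by the telescoping increments of the scalar majorant, which stays
    below 1, so their series converges absolutely in the complete space [H]. *)
Lemma sqrt_iter_is_cvg x : cvgn (fun n => Y n x).
Proof.
have -> : (fun n => Y n x) = series (fun n => Y n.+1 x - Y n x).
  by apply/funext => n; rewrite /series/= telescope_sumr// /Y/= subr0.
apply: normed_cvg.
apply: nondecreasing_is_cvgn; first by apply: nondecreasing_series => *; exact: normr_ge0.
exists `|x| => _ [n _ <-]; rewrite /series/=.
apply: (@le_trans _ _ (\sum_(0 <= k < n)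
    (sqrt_iter_bound k.+1 - sqrt_iter_bound k) * `|x|)).
  by apply: ler_sum => k _; exact: sqrt_iter_step.
rewrite -mulr_suml telescope_sumr// subr0.
have /andP[? ?] := sqrt_iter_bound01 n.
by rewrite ler_piMl.
Qed.

(** The last clause is the fixed-point equation of the iteration; it says that [1 - Z] squares to
    [1 - T]. *)
Lemma contraction_sqrt : exists Z : H -> H,
  [/\ forall a x y, Z (a *: x + y) = a *: Z x + Z y,
      forall x y, inner (Z x) y = inner x (Z y),
      forall x, `|Z x| <= `|x| &
      forall x, Z (Z x) = 2 *: Z x - T x].
Proof.
pose Z x := limn (fun n => Y n x).
have YZ x : Y n x @[n --> \oo] --> Z x by exact: sqrt_iter_is_cvg.
have Yle n x : `|Y n x| <= `|x|.
  have /andP[? ?] := sqrt_iter_bound01 n.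
  by rewrite (le_trans (sqrt_iter_le n x))// ler_piMl.
exists Z; split => [a x y|x y|x|x].
- apply: cvg_lim => //; under eq_fun do rewrite sqrt_iter_linear.
  by apply: cvgD => //; apply: cvgZr.
- have h1 : inner (Y n y) x @[n --> \oo] --> inner (Z x) y.
    have -> : (fun n => inner (Y n y) x) = (fun n => inner (Y n x) y).
      by apply/funext => n; rewrite sqrt_iter_sym innerC.
    exact: cvg_innerl.
  by rewrite (innerC x); exact: (cvg_unique _ h1 (@cvg_innerl _ _ x (YZ y))).
- have h : `|Y n x| @[n --> \oo] --> `|Z x| by exact: cvg_norm (YZ x).
  rewrite -(cvg_lim _ h)//; apply: limr_le; first by apply/cvg_ex; eexists; exact: h.
  by apply: nearW => n; exact: Yle.
(* Operator and argument vary together; the uniform bound [Yle] reduces [Y n (Y n x)] to the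
   pointwise limit at the fixed argument [Z x]. *)
- have h0 : Y n (Y n x - Z x) @[n --> \oo] --> (0 : H).
    apply/norm_cvg0P; apply: (@squeeze_cvgr _ _ _ _ (fun=> 0) (fun n => `|Y n x - Z x|)).
    + by apply: nearW => n; rewrite normr_ge0 Yle.
    + exact: cvg_cst.
    + apply/norm_cvg0P; rewrite -(subrr (Z x)); apply: cvgB => //; exact: cvg_cst.
  have h1 : Y n (Y n x) @[n --> \oo] --> Z (Z x).
    have -> : (fun n => Y n (Y n x)) = (fun n => Y n (Y n x - Z x) + Y n (Z x)).
      by apply/funext => n; rewrite (linear_opB (@sqrt_iter_linear n)) subrK.
    by rewrite -[Z (Z x)]add0r; apply: cvgD.
  have h2 : Y n.+1 x @[n --> \oo] --> Z x by rewrite (cvg_shiftS (fun n => Y n x)).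
  have h3 : 2^-1 *: (T x + Y n (Y n x)) @[n --> \oo] --> 2^-1 *: (T x + Z (Z x)).
    by apply: cvgZr; apply: cvgD => //; exact: cvg_cst.
  have ZE : Z x = 2^-1 *: (T x + Z (Z x)) by exact: (cvg_unique _ h2 h3).
  by rewrite [in RHS]ZE scalerA divff// scale1r addrAC subrr add0r.
Qed.

End SqrtContraction.

(** * Inverse square root of a regularized positive operator *)

Section RegularizedInverse.
Variables (V C : H -> H) (rho : R).
Hypothesis rho0 : 0 < rho.
Hypothesis V_linear : forall a x y, V (a *: x + y) = a *: V x + V y.
Hypothesis V_sym : forall x y, inner (V x) y = inner x (V y).
Hypothesis V_ge0 : forall x, 0 <= inner x (V x).
Hypothesis CA : forall x, C (rho *: x + V x) = x.
Hypothesis AC : forall x, rho *: C x + V (C x) = x.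

Lemma inverse_linear a x y : C (a *: x + y) = a *: C x + C y.
Proof.
rewrite -[RHS]CA V_linear scalerDr addrACA AC; congr (C (_ + _)).
by rewrite -{1}(AC x) scalerDr !scalerA (mulrC a).
Qed.

Lemma inverse_sym x y : inner (C x) y = inner x (C y).
Proof.
by rewrite -{1}(AC y) -{2}(AC x) innerDr innerDl innerZr innerZl V_sym.
Qed.

Lemma inverse_ge0 x : 0 <= inner x (C x).
Proof.
rewrite -{1}(AC x) innerDl innerZl inner_norm (innerC (V _)).
by rewrite addr_ge0// mulr_ge0// ?sqr_ge0// ltW.
Qed.

Lemma inv_sqrt_exists : exists B, is_inv_sqrt inner (fun x => rho *: x + V x) B.
Proof.
pose T x := x - rho *: C x.
have TE x : T x = V (C x) by rewrite /T -{1}(AC x) addrC addKr.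
have [] := @contraction_sqrt T.
- move=> a x y; rewrite /T inverse_linear scalerDr scalerBr !scalerA (mulrC a).
  by rewrite opprD addrACA.
- move=> x y; rewrite /T innerDl innerDr innerNl innerNr innerZl innerZr inverse_sym.
  by [].
(* Here [x = rho C x + V C x] and [T x = V C x]; in the expansion of [|x|^2] the cross term is
   nonnegative because [V] is. *)
- move=> x; rewrite TE -{2}(AC x) -(@ler_pXn2r _ 2)// ?nnegrE//.
  rewrite sqr_normD innerZl.
  have := mulr_ge0 (ltW rho0) (V_ge0 (C x)); have := sqr_ge0 `|rho *: C x|; lra.
move=> Y [Y_linear Y_sym Y_le Y_sqr].
pose r := (Num.sqrt rho)^-1.
have r0 : 0 <= r by rewrite invr_ge0 sqrtr_ge0.
have rr : r * r = rho^-1 by rewrite -invfM -expr2 sqr_sqrtr// ltW.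
(* Since [(1 - Y)^2 = 1 - T = rho C], scaling by [rho^(-1/2)] gives a square root of [C]; it is
   positive and continuous because [Y] is a contraction. *)
pose B x := r *: (x - Y x).
have B_linear a x y : B (a *: x + y) = a *: B x + B y.
  rewrite /B Y_linear opprD addrACA scalerDr -scalerBr !scalerA; congr (_ + _).
  by rewrite mulrC.
have BB x : B (B x) = C x.
  rewrite {1}/B (linear_opZ Y_linear) -scalerBr scalerA rr (linear_opB Y_linear) Y_sqr.
  have -> : x - Y x - (Y x - (2 *: Y x - T x)) = rho *: C x.
    rewrite opprB scaler_nat mulr2n -[Y x + Y x - T x]addrA (addrC (Y x) (_ - _)).
    by rewrite addrK addrA subrK subKr.
  by rewrite scalerA mulVf ?gt_eqF// scale1r.
exists B; split.
- exact: B_linear.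
- move=> x; apply: cvgZr; apply: cvgB => //.
  apply/cvgrPdist_le => e e0.
  have : \forall y \near x, `|x - y| <= e by apply: cvgr_dist_le.
  apply: filterS => y; apply: le_trans.
  by rewrite -(linear_opB Y_linear) Y_le.
- by move=> x y; rewrite /B innerZl innerZr innerDl innerDr innerNl innerNr Y_sym.
- move=> x; rewrite innerZr mulr_ge0// innerDr innerNr inner_norm subr_ge0.
  by rewrite (le_trans (inner_le_norm _ _))// expr2 ler_wpM2l.
- by move=> x; rewrite !BB; split; [exact: CA|exact: AC].
Qed.


Let B := op_inv_sqrt inner (fun x => rho *: x + V x).

Lemma op_inv_sqrtP : is_inv_sqrt inner (fun x => rho *: x + V x) B.
Proof. exact: (epsilon_spec (inhabits (@id H)) _ inv_sqrt_exists). Qed.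

Lemma op_inv_sqrt_linear a x y : B (a *: x + y) = a *: B x + B y.
Proof. by have [-> _ _ _ _] := op_inv_sqrtP. Qed.

(** Applying [B (B (A z)) = z] to [z = C y] gives [B (B y) = C y]. Norms of the chosen square root
    thereby become expressions in the explicit inverse [C]. *)
Lemma inner_inv_sqrt x y : inner (B x) (B y) = inner x (C y).
Proof.
have [_ _ B_sym _ B_inv] := op_inv_sqrtP.
by rewrite B_sym; have [+ _] := B_inv (C y); rewrite AC => ->.
Qed.

End RegularizedInverse.

(** * Gram operators and their recursive inverses *)

Definition gram_op (X : nat -> H) t : H -> H :=
  fun z => \sum_(1 <= i < t.+1) rank1 inner (X i) (X i) z.

(* Sherman-Morrison: the inverse of [A + x x^T] from the inverse [C] of [A]. *)
Definition rank1_update_inv (C : H -> H) (x z : H) : H :=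
  C z - (inner x (C z) / (1 + inner x (C x))) *: C x.

Fixpoint gram_inv (rho : R) (X : nat -> H) t : H -> H :=
  if t is s.+1 then rank1_update_inv (gram_inv rho X s) (X t)
  else fun z => rho^-1 *: z.

Definition gram_inv_sqrt (rho : R) (X : nat -> H) t : H -> H :=
  op_inv_sqrt inner (fun x => rho *: x + gram_op X t x).

Section Gram.
Variables (X : nat -> H) (rho : R).
Hypothesis rho0 : 0 < rho.

Lemma gram_opS t z : gram_op X t.+1 z = gram_op X t z + inner (X t.+1) z *: X t.+1.
Proof. by rewrite /gram_op big_nat_recr. Qed.

Lemma gram_op_linear t a x y :
  gram_op X t (a *: x + y) = a *: gram_op X t x + gram_op X t y.
Proof.
rewrite /gram_op scaler_sumr -big_split/=; apply: eq_bigr => i _.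
by rewrite /rank1 innerDr innerZr scalerDl scalerA.
Qed.

Lemma gram_op_sym t x y : inner (gram_op X t x) y = inner x (gram_op X t y).
Proof.
rewrite inner_suml inner_sumr; apply: eq_bigr => i _.
by rewrite /rank1 innerZl innerZr mulrC (innerC x).
Qed.

Lemma gram_op_ge0 t x : 0 <= inner x (gram_op X t x).
Proof.
rewrite inner_sumr; apply: sumr_ge0 => i _.
by rewrite /rank1 innerZr (innerC x) -expr2 sqr_ge0.
Qed.

Lemma gram_inv_spec t :
  (forall z, gram_inv rho X t (rho *: z + gram_op X t z) = z) /\
  (forall z, rho *: gram_inv rho X t z + gram_op X t (gram_inv rho X t z) = z).
Proof.
elim: t => [|t [CA AC]].
  by split => z; rewrite /gram_op big_geq//= addr0 scalerA ?mulVf ?mulfV ?gt_eqF// scale1r.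
have C_linear := inverse_linear (@gram_op_linear t) CA AC.
have g0 : 1 + inner (X t.+1) (gram_inv rho X t (X t.+1)) != 0.
  rewrite gt_eqF// ltr_pwDl//.
  exact: (inverse_ge0 rho0 (@gram_op_ge0 t) AC).
split => z; rewrite /= /rank1_update_inv gram_opS.
  rewrite addrA (linear_opD C_linear) CA (linear_opZ C_linear).
  rewrite innerDr innerZr -{2}[inner _ z]mulr1 -mulrDr mulfK//.
  by rewrite addrK.
set C := gram_inv rho X t; set x := X t.+1; set k := _ / _.
rewrite innerDr innerNr innerZr.
rewrite -scaleNr scalerDr (linear_opD (@gram_op_linear t)).
rewrite (linear_opZ (@gram_op_linear t)) scalerA (mulrC rho) -scalerA addrA.
have -> : rho *: C z + - k *: (rho *: C x) + (gram_op X t (C z) + - k *: gram_op X t (C x))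
   = z - k *: x.
  by rewrite addrACA AC -scalerDr AC scaleNr.
rewrite -addrA -scaleNr -scalerDl.
(* The equation that determines [k] in the rank-one correction; its denominator is nonzero by
   [g0]. *)
have -> : - k + (inner x (C z) - k * inner x (C x)) = 0; last by rewrite scale0r addr0.
by rewrite /k; field.
Qed.

Local Notation C := (gram_inv rho X).
Local Notation K := (gram_inv_sqrt rho X).
Let CA t := (gram_inv_spec t).1.
Let AC t := (gram_inv_spec t).2.

Lemma gram_inv_sym t x y : inner (C t x) y = inner x (C t y).
Proof. exact: (inverse_sym (@gram_op_sym t) (AC t)). Qed.

Lemma gram_inv_ge0 t x : 0 <= inner x (C t x).
Proof. exact: (inverse_ge0 rho0 (@gram_op_ge0 t) (AC t)). Qed.

Lemma gram_inv_sqrt_linear t a x y : K t (a *: x + y) = a *: K t x + K t y.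
Proof.
exact: (op_inv_sqrt_linear rho0 (@gram_op_linear t) (@gram_op_sym t)
  (@gram_op_ge0 t) (CA t) (AC t)).
Qed.

Lemma inner_gram_inv_sqrt t x y : inner (K t x) (K t y) = inner x (C t y).
Proof.
exact: (inner_inv_sqrt rho0 (@gram_op_linear t) (@gram_op_sym t)
  (@gram_op_ge0 t) (CA t) (AC t)).
Qed.

Lemma norm_gram_inv_sqrt t x : `|K t x| = Num.sqrt (inner x (C t x)).
Proof. by rewrite -inner_gram_inv_sqrt inner_norm sqrtr_sqr normr_id. Qed.

Lemma inner_gram_invS t x y : inner x (C t.+1 y) = inner x (C t y) -
  inner (X t.+1) (C t y) / (1 + inner (X t.+1) (C t (X t.+1))) *
  inner x (C t (X t.+1)).
Proof. by rewrite /= /rank1_update_inv innerDr innerNr innerZr. Qed.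

(** The rank-one update subtracts the square of [<X_(t+1), C_t x>] over a positive number from
    [<x, C_t x>]. *)
Lemma norm_gram_inv_sqrtS_le t x : `|K t.+1 x| <= `|K t x|.
Proof.
rewrite !norm_gram_inv_sqrt ler_wsqrtr// inner_gram_invS gerBl.
rewrite -(gram_inv_sym _ x) (innerC (C t x)) mulrAC -expr2 divr_ge0 ?sqr_ge0//.
by rewrite addr_ge0// gram_inv_ge0.
Qed.

Lemma norm_gram_inv_sqrt_le1 t : `|K t.+1 (X t.+1)| <= 1.
Proof.
rewrite norm_gram_inv_sqrt -sqrtr1 ler_wsqrtr// inner_gram_invS.
have := gram_inv_ge0 t (X t.+1); set g := inner _ _ => g0.
(* The squared leverage is thus [g / (1 + g)], with [g] computed from the previous inverse. *)
have -> : g - g / (1 + g) * g = g / (1 + g) by field; lra.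
by rewrite ler_pdivrMr ?mul1r; lra.
Qed.

(** For [K_t x] nonzero, the derivative at [s = 0] of [cosh (lambda |K_t (x + s X_t)|)]; by the
    division convention it is [0] when [K_t x = 0]. At [x = M_(t-1)] it involves only data known
    before time [t]. *)
Definition cosh_slope (lambda : R) t (x : H) : R :=
  lambda * (inner x (C t (X t)) / `|K t x| *
    ((expR (lambda * `|K t x|) - expR (- (lambda * `|K t x|))) / 2)).

Lemma cosh_step_le (lambda s : R) t x : 0 < lambda ->
  cosh (lambda * `|K t.+1 (x + s *: X t.+1)|) <=
  cosh (lambda * `|K t.+1 x|) * (1 + `|K t.+1 (X t.+1)| ^+ 2 *
    (expR (lambda * `|s|) - lambda * `|s| - 1)) + s * cosh_slope lambda t.+1 x.
Proof.
move=> lambda0; have lambda_ge0 := ltW lambda0.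
rewrite (addrC x) gram_inv_sqrt_linear addrC /cosh_slope.
set u := K t.+1 x; set v := K t.+1 (X t.+1).
have normZ z : lambda * `|z| = `|lambda *: z| by rewrite normrZ ger0_norm.
have := cosh_norm_shift_le (lambda *: u) (lambda *: v) s.
rewrite scalerA (mulrC s) -scalerA -scalerDr -!normZ.
rewrite innerZl innerZr inner_gram_inv_sqrt => /le_trans; apply.
apply: lerD.
  apply: ler_wpM2l; first exact: cosh_ge0.
  have -> : `|s| * (lambda * `|v|) = `|v| * (lambda * `|s|) by ring.
  have : expR (`|v| * (lambda * `|s|)) - `|v| * (lambda * `|s|) - 1 <=
      `|v| ^+ 2 * (expR (lambda * `|s|) - lambda * `|s| - 1).
    by rewrite expR_sub_affine_scale ?normr_ge0 ?norm_gram_inv_sqrt_le1// mulr_ge0.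
  lra.
rewrite le_eqVlt; apply/orP; left; apply/eqP; congr (_ * _); rewrite !mulrA; congr (_ * _ * _).
have [->|u0] := eqVneq `|u| 0; first by rewrite mulr0 !invr0 !mulr0.
by field; rewrite u0 gt_eqF.
Qed.

End Gram.

End HilbertOperators.

(** * Sub-sigma-algebras and supermartingales *)

Section SubSigmaAlgebra.
Context (d : measure_display) (Omega : measurableType d) (R : realType).
Implicit Types (G : set (set Omega)).

(** Equipping [Omega] with the structure generated by [G], which is [G] itself for a sigma-algebra,
    makes the closure properties of measurable functions apply relative to [G]. *)
Definition sub_measurable G d' (T : measurableType d') (f : Omega -> T) :=
  measurable_fun [set: g_sigma_algebraType G] (f : g_sigma_algebraType G -> T).

Lemma sub_measurableP G d' (T : measurableType d') (f : Omega -> T) :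
  sigma_algebra setT G ->
  sub_measurable G f <-> (forall Y, measurable Y -> G (f @^-1` Y)).
Proof.
move=> sG; split => [mf Y mY|Gf].
  by have := mf measurableT Y mY; rewrite setTI measurable_g_measurableTypeE.
by move=> _ Y mY; rewrite setTI measurable_g_measurableTypeE//; exact: Gf.
Qed.

Lemma sub_measurableS G G' d' (T : measurableType d') (f : Omega -> T) :
  sigma_algebra setT G -> sigma_algebra setT G' -> G `<=` G' ->
  sub_measurable G f -> sub_measurable G' f.
Proof.
by move=> sG sG' GG' /(sub_measurableP _ sG) Gf;
  apply/sub_measurableP => // Y /Gf/GG'.
Qed.

Lemma sub_measurableW G d' (T : measurableType d') (f : Omega -> T) :
  sigma_algebra setT G -> G `<=` measurable ->
  sub_measurable G f -> measurable_fun setT f.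
Proof.
by move=> sG Gm /(sub_measurableP _ sG) Gf _ Y /Gf/Gm; rewrite setTI.
Qed.

Lemma meas_wrt_sub G (f : Omega -> R) : sigma_algebra setT G ->
  meas_wrt G f <-> sub_measurable G f.
Proof.
move=> sG; split => [mf|/(sub_measurableP _ sG) mf U oU]; last first.
  by apply: mf; exact: open_measurable.
apply: (measurability _ (RGenOpens.measurableE R)) => _ [_ [a [b ->]] <-].
rewrite setTI measurable_g_measurableTypeE//; by apply: mf; exact: interval_open.
Qed.

Lemma meas_wrt_sub_ereal G (f : Omega -> \bar R) : sigma_algebra setT G ->
  meas_wrt G f -> sub_measurable G f.
Proof.
move=> sG mf; apply: (measurability _ (ErealGenOInfty.measurableE R)).
move=> _ [_ [r ->] <-].
rewrite setTI measurable_g_measurableTypeE//; apply: mf.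
rewrite (_ : `]r%:E, +oo[%classic = [set y | (r%:E < y)%E]).
  exact: open_ereal_gt_ereal.
by apply/seteqP; split => x /=; rewrite in_itv/= andbT.
Qed.

Local Open Scope ereal_scope.

(** * Integral inequalities under measurable weights *)

Section Tower.
Variables (mu : {measure set Omega -> \bar R}) (G : set (set Omega)).
Hypotheses (sG : sigma_algebra setT G) (Gm : G `<=` measurable).
Import HBNNSimple.

Let GI A B : G A -> G B -> G (A `&` B).
Proof.
rewrite -(measurable_g_measurableTypeE sG) => mA mB; exact: measurableI.
Qed.

Lemma le_integral_nnsfunM (k : {nnsfun g_sigma_algebraType G >-> R})
    (f g : Omega -> \bar R) :
  measurable_fun setT f -> measurable_fun setT g ->
  (forall w, 0 <= f w) -> (forall w, 0 <= g w) ->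
  (forall A, G A -> \int[mu]_(w in A) f w <= \int[mu]_(w in A) g w) ->
  forall A, G A -> \int[mu]_(w in A) ((k w)%:E * f w) <=
                   \int[mu]_(w in A) ((k w)%:E * g w).
Proof.
move=> mf mg f0 g0 fg A GA.
have mk : measurable_fun setT (k : Omega -> R).
  exact: (sub_measurableW sG Gm (@measurable_funPT _ _ _ _ k)).
(* The level sets of [k] inside [A] belong to [G], and on each of them the weight is a nonnegative
   constant. *)
pose B r : set Omega := A `&` k @^-1` [set r].
have GB r : G (B r).
  apply: GI => //; have /(sub_measurableP _ sG) := @measurable_funPT _ _ _ _ k.
  by apply; exact: measurable_set1.
pose s : seq R := finmap.enum_fset (fset_set (range k)).
have AE : A = \big[setU/set0]_(r <- s) B r.
  rewrite -bigcup_seq; apply/seteqP; split => [w Aw|w [r _ []]//].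
  by exists (k w) => //=; rewrite /s in_fset_set// inE; exists w.
have tB : trivIset [set` s] B.
  by move=> r r' _ _ [w [[_ <-] [_ <-]]].
have intE h : measurable_fun setT h -> (forall w, 0 <= h w) ->
    \int[mu]_(w in A) ((k w)%:E * h w) =
    \sum_(r <- s) r%:E * \int[mu]_(w in B r) h w.
  move=> mh h0; rewrite {1}AE ge0_integral_bigsetU//=.
  - apply: eq_big_seq => r rs.
    rewrite -ge0_integralZl//.
    + by apply: eq_integral => w; rewrite inE => -[_ <-].
    + exact: Gm.
    + exact: measurable_funTS.
    + move: rs; rewrite /s in_fset_set// inE => -[w _ <-].
      by rewrite lee_fin.
  - by move=> r; exact: Gm.
  - exact: finmap.fset_uniq.
  - apply: measurable_funTS; apply: emeasurable_funM => //.
    exact/measurable_EFinP.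
  - by move=> w _; rewrite mule_ge0// lee_fin.
rewrite !intE// !(big_seq_cond xpredT)/=; apply: lee_sum => r.
rewrite andbT /s in_fset_set// inE => -[w _ <-].
by apply: lee_wpmul2l; [rewrite lee_fin|exact: fg].
Qed.

(** Monotone convergence along simple functions of [G] increasing to [h] carries the simple case to
    the limit on both sides. *)
Lemma le_integral_subM (h : Omega -> R) (f g : Omega -> \bar R) :
  sub_measurable G h -> (forall w, (0 <= h w)%R) ->
  measurable_fun setT f -> measurable_fun setT g ->
  (forall w, 0 <= f w) -> (forall w, 0 <= g w) ->
  (forall A, G A -> \int[mu]_(w in A) f w <= \int[mu]_(w in A) g w) ->
  forall A, G A -> \int[mu]_(w in A) ((h w)%:E * f w) <=
                   \int[mu]_(w in A) ((h w)%:E * g w).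
Proof.
move=> mh h0 mf mg f0 g0 fg A GA.
have meh : measurable_fun [set: g_sigma_algebraType G] (EFin \o h).
  exact/measurable_EFinP.
pose k := nnsfun_approx measurableT meh.
have k_cvg w : (k n w)%:E @[n --> \oo] --> (h w)%:E.
  by apply: (@cvg_nnsfun_approx _ _ _ _ measurableT _ meh) => // x _; rewrite lee_fin.
have mk n : measurable_fun setT (k n : Omega -> R).
  exact: (sub_measurableW sG Gm (@measurable_funPT _ _ _ _ (k n))).
have int_cvg u : measurable_fun setT u -> (forall w, 0 <= u w) ->
    \int[mu]_(w in A) ((k n w)%:E * u w) @[n --> \oo] -->
    \int[mu]_(w in A) ((h w)%:E * u w).
  move=> mu' u0.
  have -> : \int[mu]_(w in A) ((h w)%:E * u w) =
      \int[mu]_(w in A) limn (fun n => (k n w)%:E * u w).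
    apply: eq_integral => w _; apply/esym/cvg_lim => //.
    (* Where [h w = 0] and [u w] is infinite, continuity of the product fails; there the
       approximations are themselves [0]. *)
    have [hw0|hw0] := eqVneq (h w) 0%R.
      have kw0 n : k n w = 0%R.
        apply/eqP; rewrite eq_le fun_ge0 andbT /k nnsfun_approxE -lee_fin.
        rewrite -[leRHS]/(0%R%:E) -hw0.
        by apply: le_approx => // x _; rewrite lee_fin.
      under eq_fun do rewrite kw0 mul0e; rewrite hw0 mul0e; exact: cvg_cst.
    apply: cvgeM => //; last exact: cvg_cst.
    by rewrite /mule_def/=; case: (u w).
  apply: cvg_monotone_convergence => //.
  - exact: Gm.
  - move=> n; apply: measurable_funTS; apply: emeasurable_funM => //.
    exact/measurable_EFinP.
  - by move=> n w _; rewrite mule_ge0// lee_fin.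
  - move=> w _ m n mn; apply: lee_wpmul2r => //; rewrite lee_fin.
    by have /lefP := nd_nnsfun_approx measurableT meh mn; exact.
have lf := int_cvg f mf f0; have lg := int_cvg g mg g0.
apply: (lee_cvg_to lf lg).
by apply: nearW => n; exact: le_integral_nnsfunM.
Qed.

End Tower.
End SubSigmaAlgebra.

(** Preimages of rays are rays or everything, since [expeR] is increasing and attains every
    nonnegative level. *)
Lemma measurable_expeR (R : realType) : measurable_fun setT (@expeR R).
Proof.
apply: (measurability _ (ErealGenOInfty.measurableE R)).
move=> _ [_ [r ->] <-]; rewrite setTI.
have [r0|r0] := ltP r 0.
  rewrite (_ : _ @^-1` _ = setT)//; apply/seteqP; split => // x _ /=.
  by rewrite in_itv/= andbT (lt_le_trans _ (expeR_ge0 x))// lte_fin.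
have [y yr] := @expeR_total R r%:E r0.
rewrite (_ : _ @^-1` _ = `]y, +oo[%classic); first exact: emeasurable_itv.
by apply/seteqP; split => x /=; rewrite !in_itv/= !andbT -yr lte_expeR.
Qed.

(** * Measurability of distances and inner products *)

Section SubMeasurableFunctions.
Context (d : measure_display) (Omega : measurableType d) (R : realType).
Variable G : set (set Omega).
Hypothesis sG : sigma_algebra setT G.

Lemma sub_measurable_norm_dist (H : completeNormedModType R) (D : set H)
    (f g : Omega -> H) : countable D -> closure D = setT ->
  meas_wrt G f -> meas_wrt G g -> sub_measurable G (fun w => `|f w - g w|).
Proof.
move=> cD dD mf mg.
have mdist (u : Omega -> H) c : meas_wrt G u -> sub_measurable G (fun w => `|u w - c|).
  move=> mu; apply/meas_wrt_sub => // U oU.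
  rewrite -[_ @^-1` U]/(u @^-1` ((fun x => `|x - c|) @^-1` U)); apply: mu.
  have /continuousP : continuous (fun x : H => `|x - c|).
    by move=> x; apply: cvg_norm; apply: cvgB => //; exact: cvg_cst.
  by apply.
(* [|x - y|] is the infimum of [|x - c| + |y - c|] over the dense set [D]. *)
apply: (measurability _ (RGenInftyO.measurableE R)) => _ [_ [r ->] <-].
rewrite setTI.
have [D0|[e]] := pfcard_geP cD.
  by move/eqP : dD; rewrite D0 closure0 eq_sym => /eqP/seteqP[/(_ 0)]; case.
have -> : (fun w => `|f w - g w|) @^-1` `]-oo, r[%classic =
    \bigcup_n [set w | `|f w - e n| + `|g w - e n| < r].
  apply/seteqP; split => w /=; rewrite in_itv/=.
  - move=> fgr.
    (* With [c] within half the slack of [f w], the detour through [c] has length at most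
       [|f w - g w| + 2 |f w - c| < r]. *)
    have e0 : 0 < (r - `|f w - g w|) / 2 by rewrite divr_gt0// subr_gt0.
    have : closure D (f w) by rewrite dD.
    move=> /(_ _ (nbhsx_ballx _ _ e0)) [c [Dc fc]].
    have [n _ nc] := 'surj_e Dc.
    exists n => //=; rewrite nc.
    have h1 : `|f w - c| < (r - `|f w - g w|) / 2 by rewrite -ball_normE in fc.
    have h2 : `|g w - c| <= `|g w - f w| + `|f w - c|.
      by rewrite -[g w - c](subrKA (f w)) ler_normD.
    rewrite (distrC (g w) (f w)) in h2; lra.
  - move=> [n _] /=.
    have : `|f w - g w| <= `|f w - e n| + `|e n - g w|.
      by rewrite -[f w - g w](subrKA (e n)) ler_normD.
    by rewrite (distrC (e n)); lra.
apply: bigcupT_measurable => n.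
have := measurable_funD (mdist _ (e n) mf) (mdist _ (e n) mg).
move=> /(_ measurableT _ (measurable_itv `]-oo, r[)); rewrite setTI.
by congr (measurable _); apply/seteqP; split => w /=; rewrite in_itv.
Qed.

Lemma sub_measurable_inner (H : completeNormedModType R) (inner : H -> H -> R)
    (f g : Omega -> H) : is_separable_hilbert inner ->
  meas_wrt G f -> meas_wrt G g -> sub_measurable G (fun w => inner (f w) (g w)).
Proof.
move=> [innerC inner_linear inner_norm [D [cD dD]]] mf mg.
have m0 : meas_wrt G (fun=> 0 : H).
  move=> U oU; have [U0|U0] := pselect (U 0).
    rewrite (_ : _ @^-1` U = setT); last by apply/seteqP; split.
    by rewrite -(measurable_g_measurableTypeE sG); exact: measurableT.
  rewrite (_ : _ @^-1` U = set0); last by apply/seteqP; split.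
  by rewrite -(measurable_g_measurableTypeE sG); exact: measurable0.
have mnorm (u : Omega -> H) : meas_wrt G u -> sub_measurable G (fun w => `|u w| : R).
  move=> mu; have := sub_measurable_norm_dist cD dD mu m0.
  by under eq_fun do rewrite subr0.
have -> : (fun w => inner (f w) (g w)) = (fun w =>
    (`|f w| ^+ 2 + `|g w| ^+ 2 - `|f w - g w| ^+ 2) * 2^-1).
  by apply/funext => w; rewrite (innerE_dist innerC inner_linear inner_norm).
apply: measurable_funM; last exact: measurable_cst.
apply: measurable_funB; last first.
  by apply: measurable_funX; exact: (sub_measurable_norm_dist cD dD mf mg).
by apply: measurable_funD; apply: measurable_funX; exact: mnorm.
Qed.

End SubMeasurableFunctions.

Lemma measurable_sqrt (R : realType) : measurable_fun setT (@Num.sqrt R).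
Proof. by apply: continuous_measurable_fun; exact: sqrt_continuous. Qed.

Lemma measurable_cosh (R : realType) : measurable_fun setT (@cosh R).
Proof.
apply: measurable_funM; last exact: measurable_cst.
apply: measurable_funD; first exact: measurable_expR.
by apply: measurableT_comp; [exact: measurable_expR|exact: oppr_measurable].
Qed.

Lemma measurable_fun_inv_ge0 (d : measure_display) (T : measurableType d)
    (R : realType) (f : T -> R) : measurable_fun setT f ->
  (forall x, 0 <= f x) -> measurable_fun setT (fun x => (f x)^-1).
Proof.
move=> mf f0.
have -> : (fun x => (f x)^-1) = (fun x => f x `^ (- 1)).
  by apply/funext => x; rewrite powR_inv1.
exact: (measurableT_comp (measurable_powR (- 1)) mf).
Qed.

(** * Supermartingales from integral inequalities *)

Section Supermartingale.
Context (d : measure_display) (Omega : measurableType d) (R : realType).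
Variable P : probability Omega R.
Local Open Scope ereal_scope.

(** Taking [A] to be the whole space gives integrability by induction. For a conditional expectation
    [Z] of [S t.+1], the set where [Z > S t] lies in [F t], so [Z - S t] has integral both [>= 0]
    and [<= 0] over it, and the set is null. *)
Lemma nonneg_supermartingaleI (F : nat -> set (set Omega)) (S : nat -> Omega -> R) :
  is_filtration F -> (forall t w, (0 <= S t w)%R) ->
  (forall t, sub_measurable (F t) (S t)) ->
  \int[P]_w (S 0%N w)%:E < +oo ->
  (forall t A, F t A ->
     \int[P]_(w in A) (S t.+1 w)%:E <= \int[P]_(w in A) (S t w)%:E) ->
  nonneg_supermartingale P F S.
Proof.
move=> [sF Fm _] S0 mS S0_fin S_le.
have mS' t : measurable_fun setT (S t) := sub_measurableW (sF t) (@Fm t) (mS t).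
have FT t : F t setT.
  by rewrite -(measurable_g_measurableTypeE (sF t)); exact: measurableT.
have S_int t : P.-integrable setT (EFin \o S t).
  apply/integrableP; split; first exact/measurable_EFinP.
  under eq_integral do rewrite /= ger0_norm//.
  elim: t => [//|t IH]; exact: le_lt_trans (S_le t _ (FT t)) IH.
split => //.
  by move=> t; apply/meas_wrt_sub.
move=> t Z [_ mZ Z_int ZE].
have mZs : sub_measurable (F t) Z by apply/meas_wrt_sub.
pose A := [set w | (S t w < Z w)%R].
have FA : F t A.
  have := measurable_fun_ltr (mS t) mZs.
  move=> /(_ measurableT [set true] Logic.I).
  by rewrite setTI (measurable_g_measurableTypeE (sF t)).
have mA : measurable A := Fm _ _ FA.
have Z_intA : P.-integrable A (EFin \o Z) by apply: integrableS Z_int.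
have S_intA : P.-integrable A (EFin \o S t) by apply: integrableS (S_int t).
have mD : measurable_fun A (EFin \o (Z \- S t)%R).
  apply: measurable_funTS; apply/measurable_EFinP; apply: measurable_funB => //.
  exact: (sub_measurableW (sF t) (@Fm t) mZs).
have : \int[P]_(w in A) `|(EFin \o (Z \- S t)%R) w| = 0.
  have -> : \int[P]_(w in A) `|(EFin \o (Z \- S t)%R) w| =
            \int[P]_(w in A) ((Z w)%:E - (S t w)%:E).
    apply: eq_integral => w; rewrite inE /A/= => ZS.
    by rewrite ger0_norm// subr_ge0 ltW.
  rewrite (integralB mA Z_intA S_intA); apply/eqP; rewrite eq_le; apply/andP; split.
    rewrite sube_le0; rewrite ZE//; exact: S_le.
  rewrite -(integralB mA Z_intA S_intA); apply: integral_ge0 => w; rewrite /A/= => ZS.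
  by rewrite lee_fin subr_ge0 ltW.
move/(ae_eq_integral_abs P mA mD); apply: filterS => w /= ZS.
rewrite leNgt; apply/negP => SZ.
by have [] := ZS SZ => /eqP; rewrite subr_eq0 => /eqP ZSE; move: SZ; rewrite ZSE ltxx.
Qed.

Variable G : set (set Omega).
Hypotheses (sG : sigma_algebra setT G) (Gm : G `<=` measurable).

Lemma eq_integral_subM (h : Omega -> R) (f g : Omega -> \bar R) :
  sub_measurable G h -> (forall w, (0 <= h w)%R) ->
  measurable_fun setT f -> measurable_fun setT g ->
  (forall w, 0 <= f w) -> (forall w, 0 <= g w) ->
  (forall A, G A -> \int[P]_(w in A) f w = \int[P]_(w in A) g w) ->
  forall A, G A -> \int[P]_(w in A) ((h w)%:E * f w) =
                   \int[P]_(w in A) ((h w)%:E * g w).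
Proof.
move=> mh h0 mf mg f0 g0 fg A GA; apply/eqP; rewrite eq_le.
by apply/andP; split; apply: (le_integral_subM sG Gm mh h0) => // B /fg->.
Qed.

(** * Perturbations by a centred variable *)

Section Centered.
Variable e : Omega -> R.
Hypothesis e_centered : is_cond_exp P G e (fun=> 0%R).

Let e_int : P.-integrable setT (EFin \o e). Proof. by case: e_centered. Qed.
Let me : measurable_fun setT e.
Proof. by apply/measurable_EFinP; exact: measurable_int e_int. Qed.
Let mep : measurable_fun setT (EFin \o e^\+)%R.
Proof. by apply/measurable_EFinP; exact: measurable_funrpos. Qed.
Let men : measurable_fun setT (EFin \o e^\-)%R.
Proof. by apply/measurable_EFinP; exact: measurable_funrneg. Qed.

(** Centring as an equality of nonnegative integrals, the form to which nonnegative [G]-measurable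
    weights can be applied. *)
Lemma integral_centered_pos_neg A : G A ->
  \int[P]_(w in A) (e^\+ w)%:E = \int[P]_(w in A) (e^\- w)%:E.
Proof.
move=> GA; have mA := Gm GA.
have eA : P.-integrable A (EFin \o e) by apply: integrableS e_int.
have : \int[P]_(w in A) (e w)%:E = 0.
  by case: e_centered => _ _ _ /(_ A GA) <-; rewrite integral0_eq.
rewrite -[X in X = _ -> _]/(\int[P]_(w in A) (EFin \o e) w) integralE funerpos funerneg.
move/eqP; rewrite sube_eq ?add0e; first by move/eqP.
  by have := integrable_pos_fin_num mA eA; rewrite funerpos.
by rewrite fin_num_adde_defr.
Qed.

Lemma integral_subM_centered (h : Omega -> R) A : sub_measurable G h ->
  (forall w, (0 <= h w <= 1)%R) -> G A ->
  \int[P]_(w in A) (h w * e^\+ w)%:E = \int[P]_(w in A) (h w * e^\- w)%:E /\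
  \int[P]_(w in A) (h w * e^\+ w)%:E < +oo.
Proof.
move=> mh h01 GA; have mA := Gm GA.
have h0 w : (0 <= h w)%R by have /andP[] := h01 w.
split.
  have := eq_integral_subM mh h0 mep men _ _ integral_centered_pos_neg GA.
  by apply => w; rewrite lee_fin.
have eA : P.-integrable A (EFin \o e) by apply: integrableS e_int.
have := integral_funepos_lt_pinfty mA eA; apply: le_lt_trans.
rewrite funerpos; apply: ge0_le_integral => //.
- by move=> w _; rewrite lee_fin mulr_ge0.
- apply: measurable_funTS; apply/measurable_EFinP; apply: measurable_funM.
    exact: sub_measurableW mh.
  exact: measurable_funrpos.
- exact: measurable_funTS.
- by move=> w _; rewrite lee_fin ler_piMl//; have /andP[] := h01 w.
Qed.

(* The coefficient [L] of the centred term need not make [e * L] integrable,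
   so the inequality is first weighted by [(1 + |L|)^-1]. *)
Lemma le_integral_centered_perturbation (s s' W q L phi : Omega -> R)
    (c : Omega -> \bar R) :
  (forall w, (0 <= s w)%R) -> (forall w, (0 <= s' w)%R) ->
  (forall w, (0 <= W w)%R) -> (forall w, (0 <= q w)%R) ->
  (forall w, (0 <= phi w)%R) -> (forall w, 0 <= c w) ->
  measurable_fun setT s -> measurable_fun setT s' -> measurable_fun setT phi ->
  sub_measurable G W -> sub_measurable G q -> sub_measurable G L ->
  sub_measurable G c ->
  (forall A, G A -> \int[P]_(w in A) c w = \int[P]_(w in A) (phi w)%:E) ->
  (forall w, (s' w <= W w * (1 + q w * phi w) + e w * L w)%R) ->
  (forall w, (W w)%:E * (1 + (q w)%:E * c w) <= (s w)%:E) ->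
  forall A, G A -> \int[P]_(w in A) (s' w)%:E <= \int[P]_(w in A) (s w)%:E.
Proof.
move=> s0 s'0 W0 q0 phi0 c0 ms ms' mphi mW mq mL mc cphi s'le sge.
have subW (f : Omega -> R) : sub_measurable G f -> measurable_fun setT f.
  exact: sub_measurableW.
pose D w := (1 + `|L w|)%R.
have D_gt0 w : (0 < D w)%R by rewrite ltr_pwDl.
have D0 w : (0 <= D w)%R by rewrite ltW.
have mD : sub_measurable G D.
  apply: measurable_funD; first exact: measurable_cst.
  by apply: measurableT_comp mL; exact: normr_measurable.
pose wt w := (D w)^-1%R.
have wt0 w : (0 <= wt w)%R by rewrite invr_ge0.
have mwt : sub_measurable G wt by exact: measurable_fun_inv_ge0.
(* Positive and negative parts of the weighted slope; both lie in [[0, 1]], so their products with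
   [e] are integrable. *)
pose p w := (wt w * L^\+ w)%R; pose m w := (wt w * L^\- w)%R.
have mp : sub_measurable G p.
  by apply: measurable_funM => //; exact: measurable_funrpos.
have mm : sub_measurable G m.
  by apply: measurable_funM => //; exact: measurable_funrneg.
have pmL w : (wt w * L w = p w - m w)%R.
  by rewrite /p /m -mulrBr -[in LHS](funrposBneg L).
have p01 w : (0 <= p w <= 1)%R.
  rewrite /p mulr_ge0//= /wt mulrC ler_pdivrMr// mul1r /D /funrpos.
  by rewrite ge_max; have := ler_norm (L w); have := normr_ge0 (L w); lra.
have m01 w : (0 <= m w <= 1)%R.
  rewrite /m mulr_ge0//= /wt mulrC ler_pdivrMr// mul1r /D /funrneg.
  rewrite ge_max; have := ler_norm (- L w); rewrite normrN.
  by have := normr_ge0 (L w); lra.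
(* The weight is removed at the end by multiplying back with the [G]-measurable [D]. *)
suff wt_le A : G A -> \int[P]_(w in A) (wt w * s' w)%:E <=
    \int[P]_(w in A) (wt w * s w)%:E.
  move=> A GA.
  have := @le_integral_subM _ _ _ P G sG Gm D (fun w => (wt w * s' w)%:E)
    (fun w => (wt w * s w)%:E) mD D0.
  have DwtE (f : Omega -> R) : \int[P]_(w in A) ((D w)%:E * (wt w * f w)%:E) =
      \int[P]_(w in A) (f w)%:E.
    by apply: eq_integral => w _; rewrite -EFinM mulrA mulfV ?mul1r// gt_eqF.
  rewrite -(DwtE s') -(DwtE s); apply => //.
  - by apply/measurable_EFinP; apply: measurable_funM => //; exact: subW.
  - by apply/measurable_EFinP; apply: measurable_funM => //; exact: subW.
  - by move=> w; rewrite lee_fin mulr_ge0.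
  - by move=> w; rewrite lee_fin mulr_ge0.
move=> GA; have mA := Gm GA.
have [pE p_fin] := integral_subM_centered mp p01 GA.
have [mE m_fin] := integral_subM_centered mm m01 GA.
have msub (f : Omega -> R) : measurable_fun setT f -> measurable_fun A (EFin \o f).
  by move=> mf; apply: measurable_funTS; apply/measurable_EFinP.
have mpe (f : Omega -> R) : sub_measurable G f ->
    measurable_fun setT (f \* e^\+)%R /\ measurable_fun setT (f \* e^\-)%R.
  move=> mf; split; apply: measurable_funM; rewrite ?subW//.
  - exact: subW.
  - exact: measurable_funrpos.
  - exact: subW.
  - exact: measurable_funrneg.
have [mpp mpn] := mpe _ mp; have [mmp mmn] := mpe _ mm.
have e0p w : (0 <= e^\+ w)%R by exact: funrpos_ge0.
have e0n w : (0 <= e^\- w)%R by exact: funrneg_ge0.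
have p0 w : (0 <= p w)%R by have /andP[] := p01 w.
have m0 w : (0 <= m w)%R by have /andP[] := m01 w.
(* In [(e^+ - e^-)(p - m)] the negative products [p e^- + m e^+] are moved to the left, so that
   every integrand is nonnegative. By centring, they and the positive products [p e^+ + m e^-] have
   the same finite integral [I], which cancels. *)
pose I := \int[P]_(w in A) (p w * e^\+ w)%:E + \int[P]_(w in A) (m w * e^\+ w)%:E.
have I_fin : I \is a fin_num.
  rewrite fin_numD !ge0_fin_numE ?p_fin ?m_fin//;
  by apply: integral_ge0 => w _; rewrite lee_fin mulr_ge0.
rewrite -(leeD2rE _ _ I_fin).
pose wW w := (wt w * W w)%R.
have mwW : sub_measurable G wW by exact: measurable_funM.
have wW0 w : (0 <= wW w)%R by rewrite mulr_ge0.
pose wWq w := (wt w * W w * q w)%R.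
have mwWq : sub_measurable G wWq by exact: measurable_funM.
have wWq0 w : (0 <= wWq w)%R by rewrite mulr_ge0// mulr_ge0.
have -> : \int[P]_(w in A) (wt w * s' w)%:E + I =
    \int[P]_(w in A) (wt w * s' w + (p w * e^\- w + m w * e^\+ w))%:E.
  under [RHS]eq_integral do rewrite EFinD EFinD.
  rewrite [RHS]ge0_integralD//.
  - rewrite ge0_integralD//.
    + by rewrite /I pE.
    + by move=> w _; rewrite lee_fin mulr_ge0.
    + exact: msub.
    + by move=> w _; rewrite lee_fin mulr_ge0.
    + exact: msub.
  - by move=> w _; rewrite lee_fin mulr_ge0.
  - by apply: msub; apply: measurable_funM => //; exact: subW.
  - by move=> w _; rewrite -EFinD lee_fin addr_ge0 ?mulr_ge0.
  - by apply: (msub (fun w => p w * e^\- w + m w * e^\+ w)%R); exact: measurable_funD.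
apply: (@le_trans _ _ (\int[P]_(w in A)
   ((wW w)%:E + (wWq w * phi w)%:E + ((p w * e^\+ w)%:E + (m w * e^\- w)%:E)))).
  apply: ge0_le_integral => //.
  - by move=> w _; rewrite lee_fin !addr_ge0 ?mulr_ge0.
  - apply: (msub (fun w => wt w * s' w + (p w * e^\- w + m w * e^\+ w))%R).
    apply: measurable_funD; last exact: measurable_funD.
    by apply: measurable_funM => //; exact: subW.
  - apply: (msub (fun w => wW w + wWq w * phi w + (p w * e^\+ w + m w * e^\- w))%R).
    apply: measurable_funD; last exact: measurable_funD.
    apply: measurable_funD; first exact: subW.
    by apply: measurable_funM => //; exact: subW.
  - move=> w _; rewrite -!EFinD lee_fin.
    have := ler_wpM2l (wt0 w) (s'le w).
    have := pmL w; have : (e w = e^\+ w - e^\- w)%R by rewrite -[in LHS](funrposBneg e).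
    rewrite /wW /wWq; move: (e^\+ w)%R (e^\- w)%R (p w) (m w) => a b c1 c2 -> wL.
    have -> : (wt w * (W w * (1 + q w * phi w) + (a - b) * L w) =
      wt w * W w + wt w * W w * q w * phi w + (a - b) * (wt w * L w))%R by ring.
    rewrite wL; lra.
rewrite [leLHS]ge0_integralD//; last 4 first.
  - by move=> w _; rewrite -EFinD lee_fin addr_ge0 ?mulr_ge0.
  - apply: (msub (fun w => wW w + wWq w * phi w)%R).
    apply: measurable_funD; first exact: subW.
    by apply: measurable_funM => //; exact: subW.
  - by move=> w _; rewrite -EFinD lee_fin addr_ge0 ?mulr_ge0.
  - by apply: (msub (fun w => p w * e^\+ w + m w * e^\- w)%R); exact: measurable_funD.
rewrite [X in _ + X <= _]ge0_integralD//; last 4 first.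
  - by move=> w _; rewrite lee_fin mulr_ge0.
  - exact: msub.
  - by move=> w _; rewrite lee_fin mulr_ge0.
  - exact: msub.
rewrite -mE -/I leeD2r//.
have mphiE : measurable_fun setT (EFin \o phi) by exact/measurable_EFinP.
have mcW : measurable_fun setT c by exact: sub_measurableW mc.
(* The weight [wWq] is [G]-measurable, so [phi] may be replaced by its conditional expectation [c]
   under the integral. *)
have -> : \int[P]_(w in A) ((wW w)%:E + (wWq w * phi w)%:E) =
    \int[P]_(w in A) ((wW w)%:E + (wWq w)%:E * c w).
  rewrite ge0_integralD//; last 4 first.
  - by move=> w _; rewrite lee_fin.
  - by apply: msub; exact: subW.
  - by move=> w _; rewrite lee_fin mulr_ge0.
  - by apply: (msub (fun w => wWq w * phi w)%R); apply: measurable_funM => //; exact: subW.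
  rewrite ge0_integralD//; last 4 first.
  - by move=> w _; rewrite lee_fin.
  - by apply: msub; exact: subW.
  - by move=> w _; rewrite mule_ge0// lee_fin.
  - apply: measurable_funTS; apply: emeasurable_funM => //.
    by apply/measurable_EFinP; exact: subW.
  congr (_ + _); apply/esym.
  exact: (@eq_integral_subM wWq c (EFin \o phi)).
apply: ge0_le_integral => //.
- by move=> w _; rewrite adde_ge0// ?lee_fin// mule_ge0// lee_fin.
- apply: measurable_funTS; apply: emeasurable_funD.
    by apply/measurable_EFinP; exact: subW.
  apply: emeasurable_funM => //.
  by apply/measurable_EFinP; exact: subW.
- by apply: (msub (fun w => wt w * s w)%R); apply: measurable_funM => //; exact: subW.
- move=> w _; rewrite EFinM.
  have : 0 <= (wt w)%:E by rewrite lee_fin.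
  move=> /(lee_wpmul2l) /(_ _ _ (sge w)); apply: le_trans.
  rewrite /wW /wWq !EFinM -!muleA.
  rewrite ge0_muleDr ?mule_ge0 ?lee_fin// mule1.
  by rewrite ge0_muleDr ?mule_ge0 ?lee_fin// mule_ge0 ?lee_fin ?mule_ge0 ?lee_fin.
Qed.

End Centered.
End Supermartingale.

(** * Measurability of the self-normalized sums *)

Section PredictableGram.
Context (R : realType) (H : completeNormedModType R) (inner : H -> H -> R).
Hypothesis hH : is_separable_hilbert inner.
Context (d : measure_display) (Omega : measurableType d).
Variable F : nat -> set (set Omega).
Hypothesis hF : is_filtration F.
Variables (X : nat -> Omega -> H) (eps : nat -> Omega -> R).
Hypothesis hX : forall t, (1 <= t)%N -> meas_wrt (F t.-1) (X t).
Hypothesis heps : forall t, (1 <= t)%N -> meas_wrt (F t) (eps t).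
Variable rho : R.
Hypothesis hrho : 0 < rho.

Let innerC : forall x y, inner x y = inner y x. Proof. by case: hH. Qed.
Let inner_linear : forall a x y z, inner (a *: x + y) z = a * inner x z + inner y z.
Proof. by case: hH. Qed.
Let inner_norm : forall x, inner x x = `|x| ^+ 2. Proof. by case: hH. Qed.
Let sF t : sigma_algebra setT (F t). Proof. by case: hF. Qed.

Local Notation C w t := (gram_inv inner rho (X ^~ w) t).
Local Notation K w t := (gram_inv_sqrt inner rho (X ^~ w) t).
Local Notation M m w := (\sum_(1 <= i < m.+1) eps i w *: X i w).

Lemma sub_measurable_sum_nat n (f : nat -> Omega -> R) a b :
  (forall i, (a <= i < b)%N -> sub_measurable (F n) (f i)) ->
  sub_measurable (F n) (fun w => \sum_(a <= i < b) f i w).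
Proof.
move=> mf; rewrite /sub_measurable.
under eq_fun do rewrite big_nat big_mkcond/=.
apply: measurable_sum => i; case: (boolP (a <= i < b)%N) => [/mf//|_]; exact: measurable_cst.
Qed.

Lemma sub_measurable_esum_nat n (f : nat -> Omega -> \bar R) a b :
  (forall i, (a <= i < b)%N -> sub_measurable (F n) (f i)) ->
  sub_measurable (F n) (fun w => \sum_(a <= i < b) f i w)%E.
Proof.
move=> mf; rewrite /sub_measurable.
under eq_fun do rewrite big_nat big_mkcond/=.
apply: emeasurable_sum => i; case: (boolP (a <= i < b)%N) => [/mf//|_]; exact: measurable_cst.
Qed.

(** Induction on [t] through the scalar form of Sherman-Morrison. Indices reach [n.+1] because [X]
    is predictable. *)
Lemma sub_measurable_gram n t i j : (t <= n.+1)%N ->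
  (1 <= i <= n.+1)%N -> (1 <= j <= n.+1)%N ->
  sub_measurable (F n) (fun w => inner (X i w) (C w t (X j w))).
Proof.
have mX k : (1 <= k <= n.+1)%N -> meas_wrt (F n) (X k).
  move=> /andP[k1 kn] U oU; have [_ _ F_mono] := hF.
  by apply: (F_mono k.-1); [rewrite -ltnS prednK|exact: hX].
elim: t i j => [|t IH] i j tn hi hj.
  under eq_fun do rewrite /= (innerZr innerC inner_linear).
  apply: measurable_funM; first exact: measurable_cst.
  by apply: sub_measurable_inner => //; exact: mX.
under eq_fun do rewrite (inner_gram_invS innerC inner_linear).
have ht : (1 <= t.+1 <= n.+1)%N by [].
have {}IH i' j' := IH i' j' (ltnW tn).
apply: measurable_funB; first exact: IH.
apply: measurable_funM; last exact: IH.
apply: measurable_funM; first exact: IH.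
apply: measurable_fun_inv_ge0.
  by apply: measurable_funD; [exact: measurable_cst|exact: IH].
by move=> w; rewrite addr_ge0// (gram_inv_ge0 innerC inner_linear inner_norm).
Qed.

Let sub_measurable_eps n i : (1 <= i <= n)%N -> sub_measurable (F n) (eps i).
Proof.
move=> /andP[i1 i_n]; apply/meas_wrt_sub => // U oU.
by have [_ _ F_mono] := hF; apply: (F_mono i) => //; exact: heps.
Qed.

Lemma sub_measurable_gram_score n t m : (t <= n.+1)%N -> (m <= n)%N ->
  sub_measurable (F n) (fun w => inner (M m w) (C w t (X n.+1 w))).
Proof.
move=> tn mn.
under eq_fun do rewrite (inner_suml inner_linear).
apply: sub_measurable_sum_nat => i /andP[i1 im].
under eq_fun do rewrite (innerZl inner_linear).
have i_n : (i <= n)%N by rewrite (leq_trans _ mn).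
apply: measurable_funM; first by apply: sub_measurable_eps; rewrite i1.
by apply: sub_measurable_gram; rewrite ?i1 ?ltnS//= ltnW.
Qed.

Lemma sub_measurable_gram_score2 n t m : (t <= n.+1)%N -> (m <= n)%N ->
  sub_measurable (F n) (fun w => inner (M m w) (C w t (M m w))).
Proof.
move=> tn mn.
(* Bilinear expansion leaves only noise terms up to time [m <= n] and entries already known to be
   measurable. *)
have -> : (fun w => inner (M m w) (C w t (M m w))) = (fun w =>
    \sum_(1 <= i < m.+1) \sum_(1 <= j < m.+1)
      eps i w * eps j w * inner (X j w) (C w t (X i w))).
  apply/funext => w; rewrite (inner_suml inner_linear); apply: eq_bigr => i _.
  rewrite (innerZl inner_linear).
  rewrite -(gram_inv_sym innerC inner_linear inner_norm)// innerC.
  rewrite (inner_suml inner_linear) mulr_sumr; apply: eq_bigr => j _.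
  by rewrite (innerZl inner_linear) mulrA.
apply: sub_measurable_sum_nat => i /andP[i1 im].
apply: sub_measurable_sum_nat => j /andP[j1 jm].
have i_n : (i <= n)%N by rewrite (leq_trans _ mn).
have j_n : (j <= n)%N by rewrite (leq_trans _ mn).
apply: measurable_funM.
  by apply: measurable_funM; apply: sub_measurable_eps; rewrite ?i1 ?j1.
by apply: sub_measurable_gram; rewrite ?i1 ?j1//= ltnW.
Qed.

(** Separate indices [t] and [m] cover both the current score [K_n M_n] and the mixed [K_(n+1) M_n],
    which is known at time [n]. *)
Lemma sub_measurable_norm_score n t m : (t <= n.+1)%N -> (m <= n)%N ->
  sub_measurable (F n) (fun w => `|K w t (M m w)|).
Proof.
move=> tn mn.
under eq_fun do rewrite (norm_gram_inv_sqrt innerC inner_linear inner_norm _ hrho).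
by apply: measurableT_comp; [exact: measurable_sqrt|exact: sub_measurable_gram_score2].
Qed.

Lemma sub_measurable_norm_leverage n :
  sub_measurable (F n) (fun w => `|K w n.+1 (X n.+1 w)|).
Proof.
under eq_fun do rewrite (norm_gram_inv_sqrt innerC inner_linear inner_norm _ hrho).
apply: measurableT_comp; [exact: measurable_sqrt|].
by apply: sub_measurable_gram; rewrite ?leqnn.
Qed.

Lemma sub_measurable_cosh_slope (lambda : R) n :
  sub_measurable (F n)
    (fun w => cosh_slope inner (X ^~ w) rho lambda n.+1 (M n w)).
Proof.
have mK := @sub_measurable_norm_score n n.+1 n (leqnn _) (leqnn _).
have mlK : sub_measurable (F n) (fun w => lambda * `|K w n.+1 (M n w)|).
  by apply: measurable_funM => //; exact: measurable_cst.
apply: measurable_funM; first exact: measurable_cst.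
apply: measurable_funM.
  apply: measurable_funM; first exact: sub_measurable_gram_score.
  exact: measurable_fun_inv_ge0.
apply: measurable_funM; last exact: measurable_cst.
apply: measurable_funB; apply: measurableT_comp; try exact: measurable_expR.
  exact: mlK.
by apply: measurableT_comp mlK; exact: oppr_measurable.
Qed.

End PredictableGram.

(** For finite [x] and [y] this is [1 + y <= e^y]. If either is infinite, the exponential on the
    left is [0] and so is the product, even against [1 + y = +oo]. *)
Lemma expeR_compensate (R : realType) (c c' : R) (x y : \bar R) :
  0 <= c -> c <= c' -> (0 <= x)%E -> (0 <= y)%E ->
  ((c * fine (expeR (- (x + y))))%:E * (1 + y) <= (c' * fine (expeR (- x)))%:E)%E.
Proof.
move=> c0 cc' x0 y0.
have c'0 := le_trans c0 cc'.
have zero : (0 <= (c' * fine (expeR (- x)))%:E)%E.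
  by rewrite lee_fin mulr_ge0// fine_ge0// expeR_ge0.
case: y y0 => [y| |]// y0; case: x x0 zero => [x| |]// x0 zero;
  rewrite /= ?mulr0 ?mul0e//.
rewrite -EFinD -EFinM lee_fin opprD expRD.
have h1 := expR_ge1Dx y; have h2 := expRxMexpNx_1 y.
have h3 := expR_ge0 (- x); have h4 := expR_ge0 (- y).
have h5 : expR (- y) * (1 + y) <= 1 by rewrite mulrC -[leRHS]h2 ler_wpM2r.
have -> : c * (expR (- x) * expR (- y)) * (1 + y) =
  c * expR (- x) * (expR (- y) * (1 + y)) by ring.
apply: (@le_trans _ _ (c * expR (- x) * 1)).
  by rewrite ler_wpM2l// mulr_ge0.
by rewrite mulr1 ler_wpM2r.
Qed.

(** * Assembly of the one-step bounds *)

Unset Implicit Arguments.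

(** No exponential moment is assumed, so the conditional remainder [CE] takes extended real values;
    where the compensator sum is infinite, the exponential factor is [0]. At time [0] all sums are
    empty and [S] is [1]. *)
Theorem theorem1 (R : realType) (H : completeNormedModType R)
  (inner : H -> H -> R) (hH : is_separable_hilbert inner)
  (d : measure_display) (Omega : measurableType d) (P : probability Omega R)
  (F : nat -> set (set Omega)) (hF : is_filtration F)
  (X : nat -> Omega -> H) (eps : nat -> Omega -> R)
  (hX : forall t, (1 <= t)%N -> meas_wrt (F t.-1) (X t))
  (heps : forall t, (1 <= t)%N -> meas_wrt (F t) (eps t))
  (hmean : forall t, (1 <= t)%N -> is_cond_exp P (F t.-1) (eps t) (fun _ => 0))
  (rho : R) (hrho : 0 < rho) (lambda : R) (hlambda : 0 < lambda)
  (CE : nat -> Omega -> \bar R)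
  (hCE : forall t, (1 <= t)%N ->
     is_cond_exp_nneg P (F t.-1)
       (fun w => expR (lambda * `|eps t w|) - lambda * `|eps t w| - 1) (CE t)) :
  let V t w : H -> H := fun x => \sum_(1 <= i < t.+1) rank1 inner (X i w) (X i w) x in
  let M t w : H := \sum_(1 <= i < t.+1) eps i w *: X i w in
  let K t w : H -> H := op_inv_sqrt inner (fun x => rho *: x + V t w x) in
  let G t w : H := K t w (X t w) in
  let e t w : \bar R := ((`|G t w| ^+ 2)%:E * CE t w)%E in
  let S t w : R := cosh (lambda * `|K t w (M t w)|) *
                   fine (expeR (- \sum_(1 <= i < t.+1) e i w)%E) in
  nonneg_supermartingale P F S.
Proof.
move=> V M K G e S.
have [innerC inner_linear inner_norm _] := hH; have [sF Fm F_mono] := hF.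
have KE t w : K t w = gram_inv_sqrt inner rho (X ^~ w) t by [].
have lambda_ge0 := ltW hlambda.
have CE0 t w : (1 <= t)%N -> (0 <= CE t w)%E by move=> /hCE [].
have e0 t w : (1 <= t)%N -> (0 <= e t w)%E.
  by move=> t1; rewrite mule_ge0 ?CE0// lee_fin sqr_ge0.
have sum_e0 t w : (0 <= \sum_(1 <= i < t.+1) e i w)%E.
  by rewrite big_nat_cond; apply: sume_ge0 => i /andP[/andP[i1 _] _]; exact: e0.
pose E t w := fine (expeR (- \sum_(1 <= i < t.+1) e i w)%E).
have E0 t w : 0 <= E t w by rewrite fine_ge0// expeR_ge0.
have S0 t w : 0 <= S t w by apply: mulr_ge0; [exact: cosh_ge0|exact: E0].
have mq n : sub_measurable (F n) (fun w => `|G n.+1 w| ^+ 2).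
  by apply: measurable_funX; exact: (sub_measurable_norm_leverage hH hF hX hrho).
have mCE n : sub_measurable (F n) (CE n.+1).
  by have [mc _ _] := hCE n.+1 isT; exact: meas_wrt_sub_ereal.
(* Each [e i.+1] is [F i]-measurable, so the factor at time [n.+1] is already known at time [n]. *)
have mE n t : (t <= n.+1)%N -> sub_measurable (F n) (E t).
  move=> tn; apply: measurableT_comp; first exact: fine_measurable.
  apply: measurableT_comp; first exact: measurable_expeR.
  apply: measurableT_comp; first exact: oppe_measurable.
  apply: sub_measurable_esum_nat => -[//|i] /andP[_ it].
  apply: (@sub_measurableS _ _ (F i)) => //.
    by apply: F_mono; rewrite -ltnS (leq_trans _ tn).
  apply: emeasurable_funM; last exact: mCE.
  by apply/measurable_EFinP; exact: mq.
have mcosh n t : (t <= n.+1)%N ->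
    forall m, (m <= n)%N -> sub_measurable (F n) (fun w => cosh (lambda * `|K t w (M m w)|)).
  move=> tn m mn; apply: measurableT_comp; first exact: measurable_cosh.
  apply: measurable_funM; first exact: measurable_cst.
  exact: (sub_measurable_norm_score hH hF hX heps hrho).
have mS t : sub_measurable (F t) (S t).
  by apply: measurable_funM; [exact: mcosh|exact: mE].
apply: nonneg_supermartingaleI => //.
  have S1 w : S 0%N w = 1.
    rewrite /S /M !big_geq// KE.
    rewrite (linear_op0 (gram_inv_sqrt_linear innerC inner_linear inner_norm _ hrho _)).
    by rewrite normr0 mulr0 /cosh oppr0 /= oppr0 expR0 mulr1 -mulr2n divff.
  under eq_integral do rewrite S1.
  by rewrite integral_cst// mul1e (le_lt_trans (probability_le1 P measurableT))// ltry.
move=> t A FA.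
have [epsm _ _ _] := hmean t.+1 isT.
have [_ CE_ge0 CE_int] := hCE t.+1 isT.
(* [W] measures the old score [M t] with the new operator [K t.+1]. All coefficients carry the
   predictable factor [E t.+1]; the pointwise step bound and the compensation bound then supply the
   two remaining inequalities. *)
apply: (le_integral_centered_perturbation (sF t) (@Fm t) (hmean t.+1 isT)
  (W := fun w => cosh (lambda * `|K t.+1 w (M t w)|) * E t.+1 w)
  (q := fun w => `|G t.+1 w| ^+ 2)
  (L := fun w => cosh_slope inner (X ^~ w) rho lambda t.+1 (M t w) * E t.+1 w)
  (phi := fun w => expR (lambda * `|eps t.+1 w|) - lambda * `|eps t.+1 w| - 1)
  (c := CE t.+1)) => //.
- by move=> w; rewrite mulr_ge0 ?cosh_ge0.
- by move=> w; have := expR_ge1Dx (lambda * `|eps t.+1 w|); lra.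
- exact: sub_measurableW (mS t).
- exact: sub_measurableW (mS t.+1).
- have mle : measurable_fun setT (fun w => lambda * `|eps t.+1 w|).
    apply: measurable_funM; first exact: measurable_cst.
    apply: measurableT_comp; first exact: normr_measurable.
    by apply/measurable_EFinP; exact: measurable_int epsm.
  apply: measurable_funB; last exact: measurable_cst.
  apply: measurable_funB => //.
  by apply: measurableT_comp mle; exact: measurable_expR.
- by apply: measurable_funM; [exact: mcosh|exact: mE].
- by apply: measurable_funM; [exact: (sub_measurable_cosh_slope hH hF hX heps hrho)|exact: mE].
- move=> w.
  have ME : M t.+1 w = M t w + eps t.+1 w *: X t.+1 w by rewrite /M big_nat_recr.
  have := ler_wpM2r (E0 t.+1 w) (cosh_step_le innerC inner_linear inner_norm
    (X ^~ w) hrho (eps t.+1 w) t (M t w) hlambda).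
  by rewrite -KE mulrDl (mulrAC (cosh _)) -(mulrA (eps _ _)) -ME.
- move=> w; rewrite /E big_nat_recr//=; apply: expeR_compensate => //.
  + exact: cosh_ge0.
  + apply: ler_cosh; first by rewrite mulr_ge0.
    rewrite ler_wpM2l//.
    exact: (norm_gram_inv_sqrtS_le innerC inner_linear inner_norm (X ^~ w) hrho).
  + exact: e0.
Qed.
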